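(* Let $f\in C_B[0,\infty)$. Let $(a_0(n))$ and $(a_1(n))$ be convergent real sequences satisfying $2a_0(n)-a_1(n)=1$ for all $n$, and suppose that the associated operators $V_{n,1}$ are not positive. Then, on every compact subset $A\subset[0,\infty)$, $\lim_{n\to\infty}V_{n,1}(f;x)=f(x)$ for $x\in A$.
   Context: For integers $n\ge 1$, $k\ge 0$ and $x\in[0,\infty)$ let $p_{n,k}(x)=\binom{n+k-1}{k}\frac{x^k}{(1+x)^{n+k}}$, and set $p_{n,k}=0$ for $k<0$. $C_B[0,\infty)$ denotes the space of bounded continuous real-valued functions on $[0,\infty)$. Given real sequences $a_0(n),a_1(n)$, put $a(x,n)=a_0(n)+a_1(n)x$ and $b(x,n)=a_0(n)-a_1(n)(1+x)$, and $$p^1_{n,k}(x)=a(x,n)\,p_{n+1,k}(x)+b(x,n)\,p_{n+1,k-1}(x).$$ For $n\ge 2$ the first order modification of the Baskakov-Durrmeyer operators is $$V_{n,1}(f;x)=(n-1)\sum_{k=0}^{\infty}p^1_{n,k}(x)\int_0^{\infty}p_{n,k}(t)f(t)\,dt,\qquad x\in[0,\infty).$$ The operators are called positive if $f\ge 0$ on $[0,\infty)$ implies $V_{n,1}(f;x)\ge 0$ for all $x\in[0,\infty)$ (for every $n$). *)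

(* Defs.v *)
From HB Require Import structures.
From mathcomp Require Import all_boot all_order all_algebra.
From mathcomp Require Import all_classical all_reals all_analysis.
Set Implicit Arguments.
Unset Strict Implicit.
Unset Printing Implicit Defensive.
Import Order.TTheory GRing.Theory Num.Theory.
Import numFieldNormedType.Exports.
Local Open Scope classical_set_scope.
Local Open Scope ring_scope.

(* Functions on the half-line are represented by total functions R -> R of
   which only the values on `[0, +oo[ matter. *)
Definition CB (R : realType) (f : R -> R) : Prop :=
  {within `[0, +oo[, continuous f} /\ [bounded f x | x in `[0, +oo[].

(* Only n >= 1 is meaningful: then (n + k).-1 is the true n + k - 1. *)
Definition baskakov (R : realType) (n : nat) (k : int) (x : R) : R :=
  match k with
  | Posz k => 'C((n + k).-1, k)%:R * (x ^+ k / (1 + x) ^+ (n + k))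
  | Negz _ => 0
  end.

Definition acoef (R : realType) (a0 a1 : nat -> R) (x : R) (n : nat) : R :=
  a0 n + a1 n * x.

Definition bcoef (R : realType) (a0 a1 : nat -> R) (x : R) (n : nat) : R :=
  a0 n - a1 n * (1 + x).

Definition baskakov1 (R : realType) (a0 a1 : nat -> R) (n : nat) (k : int)
    (x : R) : R :=
  acoef a0 a1 x n * baskakov n.+1 k x +
  bcoef a0 a1 x n * baskakov n.+1 (k - 1) x.

(* For n >= 2, x >= 0 and f in CB, the integrals are finite and the series
   converges absolutely, so the total operators Rintegral and lim below carry
   their usual meaning. *)
Definition V1 (R : realType) (a0 a1 : nat -> R) (n : nat) (f : R -> R)
    (x : R) : R :=
  (n%:R - 1) *
  limn [series baskakov1 a0 a1 n k%:Z x *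
    \int[lebesgue_measure]_(t in `[0, +oo[) (baskakov n k%:Z t * f t)]_k.

Definition V1_positive (R : realType) (a0 a1 : nat -> R) : Prop :=
  forall (n : nat) (f : R -> R), (2 <= n)%N -> CB f ->
    (forall t, 0 <= t -> 0 <= f t) ->
    forall x, 0 <= x -> 0 <= V1 a0 a1 n f x.

(* Main.v *)
Require Import Defs.
From mathcomp Require Import all_boot all_order all_algebra.
From mathcomp Require Import all_classical all_reals all_analysis.
From mathcomp Require Import measurable_realfun.
From mathcomp Require Import ring lra.
Import Order.TTheory GRing.Theory Num.Theory.
Import numFieldNormedType.Exports.
Local Open Scope classical_set_scope.
Local Open Scope ring_scope.

(** Write p_{n,k} for the Baskakov basis functions and
    mu_{n,k}(f) = (n - 1) \int_0^oo p_{n,k} f.  Splitting p^1_{n,k} into its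
    two summands and shifting the index in the second one gives
      V_{n,1}(f; x) = a(x,n) L_0(f; x) + b(x,n) L_1(f; x),
      L_j(f; x) = \sum_k p_{n+1,k}(x) mu_{n,k+j}(f)   (j = 0, 1).
    Both L_j are positive operators that fix the constants, whatever the signs
    of a and b.  Since a(x,n) + b(x,n) = 2 a_0(n) - a_1(n) = 1,
      V_{n,1}(f; x) - f(x) = a (L_0(f; x) - f(x)) + b (L_1(f; x) - f(x)),
    and a, b stay bounded on a compact set uniformly in n, because convergent
    sequences are bounded.  So it is enough that each L_j f tends to f
    uniformly on the compact set.

    This is a Korovkin type argument.  By compactness and boundedness,
    |f(t) - f(x)| <= e + C (t - x)^2 for x in the compact set and t >= 0
    (CB_quadratic_modulus); applying L_j bounds |L_j(f; x) - f(x)| by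
    e + C L_j((. - x)^2; x), and the second central moment is O(1/n) locally
    uniformly in x (second_moment_le).

    The moments all come from the single identity
    (k+1) p_{n,k+1}(x) = n x p_{n+1,k}(x) (baskakov_shift), which trades a
    factor k, or a factor x, for a change of indices.  It reduces everything to
    the total mass of p_{n,k} in k, equal to 1 (cvg_sum_baskakov), and in x,
    equal to 1/(n-1) (integral_baskakov). *)

Local Arguments baskakov : simpl never.

(** * Identities between the basis functions and their sums over k *)

Lemma baskakov_ge0 (R : realType) (n k : nat) (x : R) :
  0 <= x -> 0 <= baskakov n k x.
Proof.
move=> x0; rewrite /baskakov mulr_ge0// divr_ge0// exprn_ge0//.
exact: addr_ge0.
Qed.

Lemma baskakov_shift (R : realType) (n k : nat) (x : R) :
  k.+1%:R * baskakov n k.+1 x = n%:R * x * baskakov n.+1 k x.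
Proof.
rewrite /baskakov addnS addSn/= exprS.
transitivity ((k.+1 * 'C(n + k, k.+1))%:R * (x * x ^+ k / (1 + x) ^+ (n + k).+1)).
  by rewrite natrM mulrA.
by rewrite mul_bin_left addnK natrM; ring.
Qed.

Lemma baskakov_rec0 (R : realType) (n : nat) (x : R) : 0 <= x ->
  (1 + x) * baskakov n.+1 0%N x = baskakov n 0%N x.
Proof.
move=> x0; have x1 : 1 + x != 0 by rewrite gt_eqF// ltr_pwDl.
rewrite /baskakov !bin0 !addn0 exprS expr0 !mul1r invfM mulrA.
by rewrite mulfV ?mul1r.
Qed.

(** This is Pascal's rule for the binomial coefficients. *)
Lemma baskakov_rec (R : realType) (n k : nat) (x : R) : 0 <= x ->
  (1 + x) * baskakov n.+1 k.+1 x
  = baskakov n k.+1 x + x * baskakov n.+1 k x.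
Proof.
move=> x0; have x1 : 1 + x != 0 by rewrite gt_eqF// ltr_pwDl.
rewrite /baskakov !addnS !addSn/= binS natrD !exprS.
have y1 : (1 + x) ^+ (n + k) != 0 by rewrite expf_neq0.
move: y1 x1; move: ((1 + x) ^+ (n + k)) => y y1 x1.
by field; rewrite ?x1 ?y1.
Qed.

(** Summing Pascal's rule, the terms x p_{n+1,k} telescope away except the last. *)
Lemma sum_baskakov_rec (R : realType) (n K : nat) (x : R) : 0 <= x ->
  \sum_(0 <= k < K.+1) baskakov n.+1 k x
  = \sum_(0 <= k < K.+1) baskakov n k x - x * baskakov n.+1 K x.
Proof.
move=> x0; elim: K => [|K IH].
  by rewrite !big_nat1 -(baskakov_rec0 R n)//; ring.
rewrite big_nat_recr//= IH [in RHS]big_nat_recr//=.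
rewrite (_ : baskakov n K.+1 x = (1 + x) * baskakov n.+1 K.+1 x
  - x * baskakov n.+1 K x); first by ring.
by rewrite baskakov_rec//; ring.
Qed.

(** Induction on n from the degenerate case p_{0,k} = [k = 0].  By
    sum_baskakov_rec the partial sums for n + 1 differ from those for n by
    x p_{n+1,K}; as they are monotone and bounded by 1, their series converges,
    so that this last term tends to 0. *)
Lemma cvg_sum_baskakov (R : realType) (n : nat) (x : R) : 0 <= x ->
  series (fun k => baskakov n k x) @ \oo --> (1 : R).
Proof.
move=> x0; elim: n => [|n IH].
  rewrite -cvg_shiftS.
  suff -> : [sequence series (fun k => baskakov 0%N k x) k.+1]_k = cst 1.
    exact: cvg_cst.
  apply/funext => K /=; rewrite /series/= big_nat_recl//= big1 ?addr0.
    by rewrite /baskakov bin0 !expr0 divr1 mulr1.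
  by move=> k _; rewrite /baskakov add0n bin_small// mul0r.
have Hrec K : series (fun k => baskakov n.+1 k x) K.+1
    = series (fun k => baskakov n k x) K.+1 - x * baskakov n.+1 K x.
  exact: sum_baskakov_rec.
have cv : cvgn (series (fun k => baskakov n.+1 k x)).
  apply: nondecreasing_is_cvgn.
    by apply: nondecreasing_series => k _ _; exact: baskakov_ge0.
  exists 1 => _ [K _ <-].
  apply: (@le_trans _ _ (series (fun k => baskakov n.+1 k x) K.+1)).
    by rewrite /series/= big_nat_recr//= lerDl baskakov_ge0.
  rewrite Hrec (@le_trans _ _ (series (fun k => baskakov n k x) K.+1))//.
    by rewrite gerBl mulr_ge0// baskakov_ge0.
  rewrite -(cvg_lim (@Rhausdorff R) IH).
  apply: nondecreasing_cvgn_le; last by apply/cvg_ex; exists 1.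
  by apply: nondecreasing_series => k _ _; exact: baskakov_ge0.
rewrite -cvg_shiftS.
rewrite (_ : [sequence _]_ _ = (fun K => series (fun k => baskakov n k x) K.+1
  - x * baskakov n.+1 K x)); last by apply/funext => K; exact: Hrec.
have c1 : (fun K => series (fun k => baskakov n k x) K.+1) @ \oo --> (1 : R).
  by have := IH; rewrite -cvg_shiftS.
have c2 : x * baskakov n.+1 K x @[K --> \oo] --> x * 0.
  by apply: cvgMl_tmp; exact: cvg_series_cvg_0 cv.
rewrite (_ : 1 = 1 - x * 0); last by rewrite mulr0 subr0.
exact: cvgB c1 c2.
Qed.

(** baskakov_shift turns k p_{n,k} into n x p_{n+1,k-1}; the next lemma
    applies the same step twice, whence the factorial moment. *)
Lemma cvg_sum_baskakov_mean (R : realType) (n : nat) (x : R) : 0 <= x ->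
  series (fun k => baskakov n k x * k%:R) @ \oo --> n%:R * x.
Proof.
move=> x0; rewrite -cvg_shiftS.
rewrite (_ : [sequence _]_ _ = (fun K => n%:R * x *
   series (fun k => baskakov n.+1 k x) K)); last first.
  apply/funext => K /=; rewrite /series/= big_nat_recl//= mulr0 add0r mulr_sumr.
  by apply: eq_bigr => k _; rewrite mulrC baskakov_shift.
rewrite -{2}[n%:R * x]mulr1.
by apply: cvgMl_tmp; exact: cvg_sum_baskakov.
Qed.

Lemma cvg_sum_baskakov_ffact2 (R : realType) (n : nat) (x : R) : 0 <= x ->
  series (fun k => baskakov n k x * (k%:R * (k%:R - 1))) @ \oo
    --> n%:R * n.+1%:R * x ^+ 2.
Proof.
move=> x0; rewrite -cvg_shiftS.
rewrite (_ : [sequence _]_ _ = (fun K => n%:R * x *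
   series (fun k => baskakov n.+1 k x * k%:R) K)); last first.
  apply/funext => K /=; rewrite /series/= big_nat_recl//= mul0r mulr0 add0r mulr_sumr.
  apply: eq_bigr => k _; rewrite mulrA -baskakov_shift.
  by rewrite -(natr1 k); ring.
rewrite (_ : n%:R * n.+1%:R * x ^+ 2 = n%:R * x * (n.+1%:R * x)); last by ring.
by apply: cvgMl_tmp; exact: cvg_sum_baskakov_mean.
Qed.

(** * Integrals of the basis functions *)

Lemma is_derive_monomial_ratio (R : realType) (k m : nat) (x : R) : 0 <= x ->
  is_derive x (1 : R) (fun y : R => y ^+ k / (1 + y) ^+ m)
    (k%:R * x ^+ k.-1 / (1 + x) ^+ m - m%:R * x ^+ k / (1 + x) ^+ m.+1).
Proof.
move=> x0; have x1 : 1 + x != 0 by rewrite gt_eqF// ltr_pwDl.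
have xm0 : (1 + x) ^+ m != 0 by rewrite expf_neq0.
have D1 : is_derive x (1 : R) (fun y : R => (1 + y) ^+ m) (m%:R * (1 + x) ^+ m.-1).
  have D0 : is_derive x (1 : R) (fun y : R => 1 + y) 1.
    have := is_deriveD (is_derive_cst (1:R) x (1:R)) (is_derive_id x (1 : R)).
    by rewrite add0r.
  have H := is_deriveX m D0; rewrite exprfctE in H.
  by apply: (is_derive_eq H); rewrite /GRing.scale/= mulr1.
have D2 := @is_deriveV R (fun y => (1 + y) ^+ m) x _ 1 xm0 D1.
have D3 : is_derive x (1 : R) (fun y : R => y ^+ k) (k%:R * x ^+ k.-1).
  have H := is_deriveX k (is_derive_id x (1 : R)); rewrite exprfctE in H.
  by apply: (is_derive_eq H); rewrite /GRing.scale/= mulr1.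
apply: (is_derive_eq (is_deriveM D3 D2)).
rewrite /GRing.scale/=.
case: m {D1 D2} xm0 => [|m] xm0; first by rewrite !mul0r; ring.
move: xm0; rewrite /= !exprS mulf_eq0 negb_or => /andP[_ xm0].
by field; rewrite ?x1 ?xm0.
Qed.

(** The index k - 1 is an integer so that p_{n+1,-1} = 0 covers the case k = 0. *)
Lemma is_derive_baskakov (R : realType) (n k : nat) (x : R) : 0 <= x ->
  is_derive x (1 : R) (baskakov n k)
    (n%:R * (baskakov n.+1 (k%:Z - 1) x - baskakov n.+1 k x)).
Proof.
move=> x0.
have D := is_deriveZ 'C((n + k).-1, k)%:R (is_derive_monomial_ratio R k (n + k) x x0).
apply: (is_derive_eq D); rewrite /GRing.scale/=.
case: k {D} => [|k].
  by rewrite /baskakov/= !bin0 !addn0 !expr0 !mul0r; ring.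
rewrite (_ : k.+1%:Z - 1 = k%:Z); last by rewrite -addn1 PoszD addrK.
rewrite !mulrBr /baskakov addSn/= addnS/=; congr (_ - _).
  rewrite !mulrA; congr (_ / _); rewrite -!natrM.
  by rewrite mulnC mul_bin_left addnK.
rewrite addSn/= addnS !mulrA; congr (_ / _); congr (_ * _); rewrite -!natrM mulnC.
by have := mul_bin_down (n + k).+1 k.+1; rewrite subSS addnK/= => ->.
Qed.

Lemma baskakov_le (R : realType) (n k : nat) (x : R) : 0 <= x ->
  baskakov n.+1 k x <= 'C(n + k, k)%:R / (1 + x).
Proof.
move=> x0; rewrite /baskakov addSn/= ler_wpM2l//.
have x1 : 0 < 1 + x by rewrite ltr_pwDl.
rewrite ler_pdivrMr ?exprn_gt0// exprS mulrA mulVf ?gt_eqF// mul1r exprD.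
apply: (@le_trans _ _ ((1 + x) ^+ k)).
  by rewrite lerXn2r ?nnegrE ?(ltW x1)// lerDr.
by rewrite ler_peMl ?exprn_ege1 ?exprn_ge0// ?(ltW x1)// lerDl.
Qed.

Lemma cvg_baskakov_pinfty (R : realType) (n k : nat) :
  baskakov n.+1 k x @[x --> +oo] --> (0 : R).
Proof.
apply: (@squeeze_cvgr _ _ _ _ (cst 0) (fun x : R => 'C(n + k, k)%:R / (1 + x))).
- near=> x; rewrite /= baskakov_ge0 ?baskakov_le//.
- exact: cvg_cst.
- rewrite (_ : 0 = 'C(n + k, k)%:R * 0); last by rewrite mulr0.
  apply: cvgMl_tmp; apply/gtr0_cvgV0.
    by near=> x; rewrite ltr_pwDl.
  apply/cvgryPge => M; near=> x.
  by rewrite -lerBlDl; near: x; apply: nbhs_pinfty_ge; exact: num_real.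
Unshelve. all: by end_near. Qed.

Lemma continuous_baskakov (R : realType) (n k : nat) :
  {within `[0, +oo[, continuous (baskakov n k : R -> R)}.
Proof.
apply: derivable_within_continuous => x; rewrite in_itv/= andbT => x0.
by have [] := is_derive_baskakov R n k x x0.
Qed.

(** The derivatives of is_derive_baskakov telescope.  Hence the partial sum in k
    is, up to the factor - n, an antiderivative of p_{n+1,k}. *)
Lemma is_derive_sum_baskakov (R : realType) (n k : nat) (x : R) : 0 <= x ->
  is_derive x (1 : R) (fun y : R => \sum_(0 <= j < k.+1) baskakov n j y)
    (- (n%:R * baskakov n.+1 k x)).
Proof.
move=> x0; elim: k => [|k IH].
  rewrite (_ : (fun _ => _) = baskakov n 0%N); last first.
    by apply/funext => y; rewrite big_nat1.
  apply: (is_derive_eq (is_derive_baskakov R n 0 x x0)).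
  rewrite (_ : baskakov n.+1 (0%:Z - 1) x = 0); last by [].
  by rewrite sub0r mulrN.
rewrite (_ : (fun _ => _) = (fun y => \sum_(0 <= j < k.+1) baskakov n j y)
    + baskakov n k.+1); last first.
  by apply/funext => y; rewrite big_nat_recr.
apply: (is_derive_eq (is_deriveD IH (is_derive_baskakov R n k.+1 x x0))).
rewrite (_ : k.+1%:Z - 1 = k%:Z); last by rewrite -addn1 PoszD addrK.
ring.
Qed.

(** The antiderivative F of is_derive_sum_baskakov vanishes at infinity, and at 0
    only its term j = 0 survives. *)
Lemma integral_baskakov (R : realType) (n k : nat) :
  (\int[lebesgue_measure]_(t in `[0%R, +oo[) (baskakov n.+2 k t)%:E
  = (n.+1%:R^-1 : R)%:E)%E.
Proof.
pose F (x : R) : R := - n.+1%:R^-1 * \sum_(0 <= j < k.+1) baskakov n.+1 j x.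
have dF (x : R) : 0 <= x -> is_derive x (1 : R) F (baskakov n.+2 k x).
  move=> x0.
  apply: (is_derive_eq (is_deriveZ (- n.+1%:R^-1)
    (is_derive_sum_baskakov R n.+1 k x x0))).
  by rewrite /GRing.scale/= mulrNN mulrA mulVf ?mul1r// pnatr_eq0.
rewrite (@ge0_continuous_FTC2y _ _ F _ 0).
- rewrite /F big_nat_recl// big1 => [|j _].
    rewrite /baskakov/= bin0 !addr0 expr0 expr1n divr1 !mulr1.
    by rewrite opprK add0e.
  by rewrite /baskakov/= exprS !mul0r mulr0.
- by move=> x; exact: baskakov_ge0.
- exact: continuous_baskakov.
- rewrite (_ : 0 = - n.+1%:R^-1 * \sum_(0 <= j < k.+1) 0); last first.
    by rewrite big1// mulr0.
  apply: cvgMl_tmp; apply: cvg_big => [|j _]; first exact: add_continuous.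
  exact: cvg_baskakov_pinfty.
- by move=> x /ltW /dF [].
- have [/derivable1_diffP/differentiable_continuous + _] := dF 0 (lexx _).
  exact: cvg_at_right_filter.
- move=> x; rewrite in_itv/= andbT => /ltW x0.
  by rewrite derive1E; have [_ ->] := dF x x0.
Qed.

Lemma Rintegral_baskakov (R : realType) (n k : nat) :
  \int[lebesgue_measure]_(t in `[0, +oo[) baskakov n.+2 k t = n.+1%:R^-1 :> R.
Proof. by rewrite /Rintegral integral_baskakov. Qed.

Lemma integrable_baskakov (R : realType) (n k : nat) :
  (@lebesgue_measure R).-integrable `[0, +oo[ (EFin \o baskakov n.+2 k).
Proof.
apply/integrableP; split.
  apply/measurable_EFinP; apply: subspace_continuous_measurable_fun => //.
  exact: continuous_baskakov.
under eq_integral => t.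
  rewrite inE/= in_itv/= andbT => t0; rewrite ger0_norm ?baskakov_ge0//; over.
by rewrite integral_baskakov ltry.
Qed.

(** * The Durrmeyer functionals *)

Lemma integrable_lincomb (R : realType) (a b : R) (f g : R -> R) :
  (@lebesgue_measure R).-integrable `[0, +oo[ (EFin \o f) ->
  (@lebesgue_measure R).-integrable `[0, +oo[ (EFin \o g) ->
  (@lebesgue_measure R).-integrable `[0, +oo[
    (EFin \o (fun t => a * f t + b * g t)).
Proof.
move=> fi gi.
have mD : measurable (`[0, +oo[%classic : set (measurableTypeR R)).
  exact: measurable_itv.
have := integrableD mD (integrableZl mD a fi) (integrableZl mD b gi).
exact.
Qed.

Lemma Rintegral_lincomb (R : realType) (a b : R) (f g : R -> R) :
  (@lebesgue_measure R).-integrable `[0, +oo[ (EFin \o f) ->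
  (@lebesgue_measure R).-integrable `[0, +oo[ (EFin \o g) ->
  \int[lebesgue_measure]_(t in `[0, +oo[) (a * f t + b * g t)
  = a * \int[lebesgue_measure]_(t in `[0, +oo[) f t
    + b * \int[lebesgue_measure]_(t in `[0, +oo[) g t.
Proof.
move=> fi gi.
have mD : measurable (`[0, +oo[%classic : set (measurableTypeR R)).
  exact: measurable_itv.
have fi' := integrableZl mD a fi; have gi' := integrableZl mD b gi.
by rewrite RintegralD// RintegralZl// RintegralZl.
Qed.

Lemma CB_bounded (R : realType) (f : R -> R) : CB f ->
  exists2 M, 0 < M & forall t, 0 <= t -> `|f t| <= M.
Proof.
move=> [_ /pinfty_ex_gt0[M M0 HM]]; exists M => // t t0.
by apply: HM; rewrite /= in_itv/= andbT.
Qed.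

Lemma integrable_baskakov_mul (R : realType) (n k : nat) (f : R -> R) : CB f ->
  (@lebesgue_measure R).-integrable `[0, +oo[
    (EFin \o (fun t => baskakov n.+2 k t * f t)).
Proof.
move=> fCB; have [M M0 fM] := CB_bounded R f fCB.
have mD : measurable (`[0, +oo[%classic : set (measurableTypeR R)).
  exact: measurable_itv.
have pi := integrableZl mD M (integrable_baskakov R n k).
apply: le_integrable pi => //.
  apply/measurable_EFinP; apply: measurable_funM.
    apply: subspace_continuous_measurable_fun => //; exact: continuous_baskakov.
  by apply: subspace_continuous_measurable_fun => //; exact: fCB.1.
move=> t; rewrite /= in_itv/= andbT => t0.
rewrite [leRHS](_ : _ = `|M * baskakov n.+2 k t|%:E)//.
rewrite lee_fin !normrM [leRHS]mulrC (ger0_norm (ltW M0)) ler_wpM2l//.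
exact: fM.
Qed.

(** This is (n - 1) \int_0^oo p_{n,k}(t) (t - x)^2 dt for n = N + 4; the integral
    diverges for n <= 3, whence the offset 4. *)
Definition durrmeyer_second_moment (R : realType) (N k : nat) (x : R) : R :=
  k.+1%:R * k.+2%:R / (N.+1%:R * N.+2%:R) - 2 * x * (k.+1%:R / N.+2%:R) + x ^+ 2.

(** Expanding the square, each factor t is absorbed by baskakov_shift, which
    lowers n; only integrals of basis functions are then left. *)
Lemma baskakov_sqr_dev (R : realType) (N k : nat) (a b x t : R) :
  baskakov N.+4 k t * (a + b * (t - x) ^+ 2) =
  b * (k.+1%:R * k.+2%:R / (N.+2%:R * N.+3%:R)) * baskakov N.+2 k.+2 t
  + 1 * (- (2 * b * x * (k.+1%:R / N.+3%:R)) * baskakov N.+3 k.+1 t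
  + (a + b * x ^+ 2) * baskakov N.+4 k t).
Proof.
have N2 : N.+2%:R != 0 :> R by rewrite pnatr_eq0.
have N3 : N.+3%:R != 0 :> R by rewrite pnatr_eq0.
have e1 : k.+1%:R * baskakov N.+3 k.+1 t = N.+3%:R * t * baskakov N.+4 k t.
  exact: baskakov_shift.
have e2 : k.+2%:R * baskakov N.+2 k.+2 t = N.+2%:R * t * baskakov N.+3 k.+1 t.
  exact: baskakov_shift.
have {}e1 : k.+1%:R / N.+3%:R * baskakov N.+3 k.+1 t = t * baskakov N.+4 k t.
  by rewrite mulrAC e1; move: N3; move: (N.+3%:R) => v v0; field.
have {}e2 : k.+1%:R * k.+2%:R / (N.+2%:R * N.+3%:R) * baskakov N.+2 k.+2 t
    = t ^+ 2 * baskakov N.+4 k t.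
  rewrite expr2 -[RHS]mulrA -e1.
  transitivity (k.+1%:R / (N.+2%:R * N.+3%:R) * (k.+2%:R * baskakov N.+2 k.+2 t)).
    move: N2 N3; move: (N.+2%:R) (N.+3%:R) => u v u0 v0; by field; rewrite ?u0 ?v0.
  rewrite e2; move: N2 N3; move: (N.+2%:R) (N.+3%:R) => u v u0 v0.
  by field; rewrite ?u0 ?v0.
rewrite -[b * _ * baskakov N.+2 _ _]mulrA e2.
rewrite (_ : - _ * _ = - (2 * b * x * (k.+1%:R / N.+3%:R * baskakov N.+3 k.+1 t))).
  by rewrite e1; ring.
by ring.
Qed.

Lemma integrable_baskakov_sqr_dev (R : realType) (N k : nat) (a b x : R) :
  (@lebesgue_measure R).-integrable `[0, +oo[
    (EFin \o (fun t => baskakov N.+4 k t * (a + b * (t - x) ^+ 2))).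
Proof.
rewrite (funext (baskakov_sqr_dev R N k a b x)).
apply: integrable_lincomb; first exact: integrable_baskakov.
by apply: integrable_lincomb; exact: integrable_baskakov.
Qed.

Lemma Rintegral_baskakov_sqr_dev (R : realType) (N k : nat) (a b x : R) :
  N.+3%:R * \int[lebesgue_measure]_(t in `[0, +oo[)
    (baskakov N.+4 k t * (a + b * (t - x) ^+ 2))
  = a + b * durrmeyer_second_moment R N k x.
Proof.
under eq_Rintegral do rewrite baskakov_sqr_dev.
rewrite Rintegral_lincomb; [|exact: integrable_baskakov|].
  rewrite Rintegral_lincomb; [|exact: integrable_baskakov|exact: integrable_baskakov].
  rewrite !Rintegral_baskakov /durrmeyer_second_moment.
  have N1 : N.+1%:R != 0 :> R by rewrite pnatr_eq0.
  have N2 : N.+2%:R != 0 :> R by rewrite pnatr_eq0.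
  have N3 : N.+3%:R != 0 :> R by rewrite pnatr_eq0.
  move: N1 N2 N3; move: (N.+1%:R) (N.+2%:R) (N.+3%:R) => u v w u0 v0 w0.
  by field; rewrite ?u0 ?v0 ?w0.
by apply: integrable_lincomb; exact: integrable_baskakov.
Qed.

(** Positivity and normalization of mu_{n,k}: it is monotone, so it can be applied
    to the lower and to the upper bound of f separately. *)
Lemma durrmeyer_dev (R : realType) (N k : nat) (f : R -> R) (c e C x : R) :
  CB f -> (forall t, 0 <= t -> `|f t - c| <= e + C * (t - x) ^+ 2) ->
  `|N.+3%:R * \int[lebesgue_measure]_(t in `[0, +oo[) (baskakov N.+4 k t * f t) - c|
  <= e + C * durrmeyer_second_moment R N k x.
Proof.
move=> fCB fc; have fi := integrable_baskakov_mul R N.+2 k f fCB.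
have N3 : 0 <= N.+3%:R :> R by [].
have fcE t : 0 <= t ->
    ((c - e) + (- C) * (t - x) ^+ 2 <= f t <= (c + e) + C * (t - x) ^+ 2).
  by move=> /fc; rewrite ler_norml => /andP[? ?]; apply/andP; split; lra.
rewrite ler_norml; apply/andP; split.
  suff : (c - e) + (- C) * durrmeyer_second_moment R N k x <= N.+3%:R *
    \int[lebesgue_measure]_(t in `[0, +oo[) (baskakov N.+4 k t * f t) by lra.
  rewrite -Rintegral_baskakov_sqr_dev ler_wpM2l// le_Rintegral//.
    exact: integrable_baskakov_sqr_dev.
  move=> t; rewrite /= in_itv/= andbT => t0.
  by rewrite ler_wpM2l ?baskakov_ge0//; have /andP[] := fcE t t0.
suff : N.+3%:R * \int[lebesgue_measure]_(t in `[0, +oo[) (baskakov N.+4 k t * f t)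
  <= (c + e) + C * durrmeyer_second_moment R N k x by lra.
rewrite -Rintegral_baskakov_sqr_dev ler_wpM2l// le_Rintegral//.
  exact: integrable_baskakov_sqr_dev.
move=> t; rewrite /= in_itv/= andbT => t0.
by rewrite ler_wpM2l ?baskakov_ge0//; have /andP[] := fcE t t0.
Qed.

(** * Second central moments of the operators L_j *)

(** The averaging step for the discrete variable: convergence of the weighted
    series of u comes from domination of w (u - c) by w v. *)
Lemma weighted_series_dev (R : realType) (w u v : R ^nat) (c S : R) :
  (forall k, 0 <= w k) -> series w @ \oo --> (1 : R) ->
  (forall k, `|u k - c| <= v k) ->
  series (fun k => w k * v k) @ \oo --> S ->
  exists2 l, series (fun k => w k * u k) @ \oo --> l & `|l - c| <= S.
Proof.
move=> w0 w1 uv cS; pose g k := w k * (u k - c).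
have gle k : `|g k| <= w k * v k.
  by rewrite normrM ger0_norm// ler_wpM2l.
have cwv : cvgn (series (fun k => w k * v k)) by apply/cvg_ex; exists S.
have cng : cvgn [normed series g].
  apply: (series_le_cvg _ _ gle cwv) => // k.
  exact: le_trans (gle k).
have cg : series g @ \oo --> limn (series g) := normed_cvg cng.
exists (limn (series g) + c * 1).
  rewrite (_ : series _ = fun K => series g K + c * series w K).
    by apply: cvgD => //; apply: cvgMl_tmp.
  apply/funext => K; rewrite /series/= mulr_sumr -big_split/=.
  by apply: eq_bigr => k _; rewrite /g; ring.
rewrite mulr1 addrK (le_trans (lim_series_norm cng))//.
rewrite -(cvg_lim (@Rhausdorff R) cS).
exact: lim_series_le.
Qed.

(** The mean of durrmeyer_second_moment R N (k + j) x over k under the weights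
    p_{m,k}(x), computed from the moments m x of k and m (m + 1) x^2 of
    k (k - 1); for m = N + 5 it is L_j((. - x)^2; x) with n = N + 4. *)
Definition second_moment (R : realType) (N m j : nat) (x : R) : R :=
  (m%:R * m.+1%:R * x ^+ 2 + (2 * j%:R + 4) * (m%:R * x)
     + j.+1%:R * j.+2%:R) / (N.+1%:R * N.+2%:R)
  - 2 * x * ((m%:R * x + j.+1%:R) / N.+2%:R) + x ^+ 2.

Lemma cvg_sum_baskakov_second_moment (R : realType) (N m j : nat) (x : R) : 0 <= x ->
  series (fun k => baskakov m k x * durrmeyer_second_moment R N (k + j) x) @ \oo -->
  second_moment R N m j x.
Proof.
move=> x0.
pose A : R := (N.+1%:R * N.+2%:R)^-1.
pose B : R := (2 * j%:R + 4) / (N.+1%:R * N.+2%:R) - 2 * x / N.+2%:R.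
pose D : R := j.+1%:R * j.+2%:R / (N.+1%:R * N.+2%:R)
  - 2 * x * (j.+1%:R / N.+2%:R) + x ^+ 2.
rewrite (_ : second_moment R N m j x =
  A * (m%:R * m.+1%:R * x ^+ 2) + B * (m%:R * x) + D * 1).
  (* A, B, D are the coefficients of durrmeyer_second_moment R N (k + j) x
     in k (k - 1), k and 1. *)
  rewrite (_ : series _ = fun K =>
    A * series (fun k => baskakov m k x * (k%:R * (k%:R - 1))) K
    + B * series (fun k => baskakov m k x * k%:R) K
    + D * series (fun k => baskakov m k x) K).
    apply: cvgD; [apply: cvgD|]; apply: cvgMl_tmp.
    - exact: cvg_sum_baskakov_ffact2.
    - exact: cvg_sum_baskakov_mean.
    - exact: cvg_sum_baskakov.
  apply/funext => K; rewrite /series/= !mulr_sumr -!big_split/=.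
  apply: eq_bigr => k _; rewrite /A /B /D /durrmeyer_second_moment.
  rewrite -(natr1 (k + j)) -(natr1 j) -addn2 -(addn2 j) !natrD; ring.
by rewrite /second_moment /A /B /D; ring.
Qed.

(** Over the common denominator (N + 1) (N + 2) the quadratic terms in N cancel
    in the numerator, so that the moment is of order 1/N. *)
Lemma second_moment_le (R : realType) (N j : nat) (x : R) : 0 <= x -> (j <= 1)%N ->
  second_moment R N N.+4.+1 j x
  <= 13 * (1 + x + x ^+ 2) / N.+1%:R.
Proof.
move=> x0 j1; rewrite /second_moment.
have N1 : 1 <= N.+1%:R :> R by rewrite ler1n.
have [E5 E6] : N.+4.+1%:R = N.+1%:R + 4 :> R /\ N.+4.+2%:R = N.+1%:R + 5 :> R.
  by split; rewrite -natrD !addnS addn0.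
have E2 : N.+2%:R = N.+1%:R + 1 :> R by rewrite natr1.
rewrite E5 E6 E2; move: N1; move: (N.+1%:R) => n n_ge1 {E5 E6 E2}.
have n0 : 0 < n by exact: lt_le_trans n_ge1.
have n1 : 0 < n + 1 by rewrite addr_gt0.
rewrite [leLHS](_ : _ = ((2 * n + 20) * x ^+ 2 + (2 * n + 8 * j%:R + 16) * x
  + (j%:R + 1) * (j%:R + 2)) / (n * (n + 1))); last first.
  rewrite -(natr1 j.+1) -(natr1 j); field.
  by rewrite ?gt_eqF.
rewrite ler_pdivrMr ?mulr_gt0// [leRHS]mulrA divfK ?gt_eqF//.
have nx : 0 <= (n - 1) * x by rewrite mulr_ge0// subr_ge0.
have nx2 : 0 <= (n - 1) * x ^+ 2 by rewrite mulr_ge0 ?sqr_ge0// subr_ge0.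
have x2 : 0 <= x ^+ 2 by rewrite sqr_ge0.
by case: j j1 => [|[|//]] _; lra.
Qed.

(** * Uniform convergence *)

(** The decomposition V = a L_0 + b L_1 with a + b = 1.  The deviation of the
    signed operator V is controlled by those of the positive operators L_0 and
    L_1, at the price of the factor |a| + |b|. *)
Lemma V1_dev (R : realType) (a0 a1 : nat -> R) (N : nat) (f : R -> R)
    (e C x : R) : CB f -> 0 <= x -> 0 <= C ->
  (forall t, 0 <= t -> `|f t - f x| <= e + C * (t - x) ^+ 2) ->
  2 * a0 N.+4 - a1 N.+4 = 1 ->
  `|V1 a0 a1 N.+4 f x - f x| <= (`|acoef a0 a1 x N.+4| + `|bcoef a0 a1 x N.+4|)
     * (e + C * (13 * (1 + x + x ^+ 2) / N.+1%:R)).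
Proof.
move=> fCB x0 C0 fx a01.
set a := acoef a0 a1 x N.+4; set b := bcoef a0 a1 x N.+4.
have ab : a + b = 1 by rewrite -a01 /a /b /acoef /bcoef; ring.
set B := e + _.
pose I (k : nat) : R :=
  \int[lebesgue_measure]_(t in `[0, +oo[) (baskakov N.+4 k t * f t).
have sdev j : (j <= 1)%N -> exists2 l,
    series (fun k => baskakov N.+4.+1 k x * (N.+3%:R * I (k + j)%N)) @ \oo --> l
    & `|l - f x| <= B.
  move=> j1.
  have cE : series (fun k =>
      baskakov N.+4.+1 k x * (e + C * durrmeyer_second_moment R N (k + j) x))
      @ \oo --> e * 1 + C * second_moment R N N.+4.+1 j x.
    rewrite (_ : series _ = fun K => e * series (fun k => baskakov N.+4.+1 k x) K
      + C * series (fun k =>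
          baskakov N.+4.+1 k x * durrmeyer_second_moment R N (k + j) x) K).
      apply: cvgD; apply: cvgMl_tmp; first exact: cvg_sum_baskakov.
      exact: cvg_sum_baskakov_second_moment.
    apply/funext => K; rewrite /series/= !mulr_sumr -big_split/=.
    by apply: eq_bigr => k _; ring.
  have [|||l cl lB] := weighted_series_dev R (fun k => baskakov N.+4.+1 k x)
      (fun k => N.+3%:R * I (k + j)%N) _ (f x) _ _ _ _ cE.
  - by move=> k; exact: baskakov_ge0.
  - exact: cvg_sum_baskakov.
  - by move=> k; exact: durrmeyer_dev.
  exists l; first exact: cl.
  rewrite (le_trans lB)// mulr1 lerD2l ler_wpM2l//.
  exact: second_moment_le.
have [l0 cl0 l0B] := sdev 0%N isT.
have [l1 cl1 l1B] := sdev 1%N isT.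
have N3 : N.+3%:R != 0 :> R by rewrite pnatr_eq0.
have -> : V1 a0 a1 N.+4 f x = a * l0 + b * l1.
  rewrite /V1 -[N.+4]addn1 natrD addrK addn1.
  set u := (fun k => _ * _).
  pose u0 (k : nat) : R := baskakov N.+4.+1 k x * (N.+3%:R * I (k + 0)%N).
  pose u1 (k : nat) : R := baskakov N.+4.+1 k x * (N.+3%:R * I (k + 1)%N).
  (* p^1_{n,k} contains p_{n+1,k-1}, so the second series enters with one term
     less; p_{n+1,-1} = 0 accounts for the missing one. *)
  suff cu : series u @ \oo --> N.+3%:R^-1 * (a * l0 + b * l1).
    by rewrite (cvg_lim _ cu)// mulrA mulfV// mul1r.
  rewrite -cvg_shiftS (_ : [sequence _]_ _ = fun K =>
      N.+3%:R^-1 * (a * series u0 K.+1 + b * series u1 K)).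
    apply: cvgMl_tmp; apply: cvgD; apply: cvgMl_tmp; last exact: cl1.
    by have := cl0; rewrite -cvg_shiftS.
  apply/funext => K /=; rewrite /series/= big_nat_recl// [in RHS]big_nat_recl//.
  rewrite !mulrDr addrAC -addrA !mulr_sumr; congr (_ + _).
    rewrite /u /u0 /baskakov1 /= addn0 -/a -/b.
    rewrite (_ : baskakov N.+4.+1 (0%:Z - 1) x = 0); last by [].
    by rewrite /I; field.
  rewrite -big_split/=; apply: eq_bigr => k _.
  rewrite /u /u0 /u1 /baskakov1 -/a -/b addn0 addn1 -/(I k.+1).
  rewrite (_ : k.+1%:Z - 1 = k%:Z); last by rewrite -addn1 PoszD addrK.
  by field.
have -> : a * l0 + b * l1 - f x = a * (l0 - f x) + b * (l1 - f x).
  have -> : b = 1 - a by rewrite -ab; ring.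
  by ring.
by rewrite (le_trans (ler_normD _ _))// !normrM mulrDl lerD// ler_wpM2l.
Qed.

(** For t close to x the bound is uniform continuity of f near the compact set;
    for |t - x| >= d it is |f(t) - f(x)| <= 2 M <= (2 M / d^2) (t - x)^2, where M
    bounds |f|. *)
Lemma CB_quadratic_modulus (R : realType) (f : R -> R) (A : set R) (e : R) :
  CB f -> compact A -> A `<=` `[0, +oo[ -> 0 < e ->
  exists2 C, 0 <= C & forall x t, A x -> 0 <= t ->
    `|f t - f x| <= e + C * (t - x) ^+ 2.
Proof.
move=> fCB cA A0 e0; have [M M0 fM] := CB_bounded R f fCB.
have : \forall d \near 0^'+, A `<=` [set x | 0 <= x ->
    forall t, 0 <= t -> `|t - x| < d -> `|f t - f x| < e].
  move/compact_near_coveringP : cA; apply => x Ax.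
  have /cvgrPdist_lt/(_ (e / 2)) : f y @[y --> within `[0, +oo[ (nbhs x)] --> f x.
    by move/subspace_continuousP : fCB.1; apply; exact: A0.
  rewrite divr_gt0// => /(_ isT); rewrite near_withinE => /nbhs_ballP[r /= r0 xr].
  have fr y : 0 <= y -> `|x - y| < r -> `|f x - f y| < e / 2.
    by move=> y0 xy; apply: xr => //=; rewrite in_itv/= andbT.
  near=> x' d => /= x'0 t t0 td.
  have xx' : `|x - x'| < r / 2.
    by near: x'; exact: nbhsx_ballx (divr_gt0 r0 _).
  have dr : d < r / 2.
    by near: d; apply: nbhs_right_lt; rewrite divr_gt0.
  rewrite (_ : f t - f x' = (f x - f x') - (f x - f t)); last by ring.
  rewrite (le_lt_trans (ler_normB _ _))// [ltRHS](splitr e) ltrD//; apply: fr => //.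
  rewrite (_ : x - t = (x - x') - (t - x')); last by ring.
  by rewrite (le_lt_trans (ler_normB _ _))// [ltRHS](splitr r) ltrD// (lt_trans td).
move=> near_d; near ((0 : R)^'+) => d.
have d0 : 0 < d by near: d; exact: nbhs_right_gt.
have Ad : A `<=` [set x | 0 <= x -> forall t, 0 <= t -> `|t - x| < d ->
    `|f t - f x| < e] by near: d.
exists (2 * M / d ^+ 2).
  by rewrite divr_ge0 ?sqr_ge0// mulr_ge0// ltW.
move=> x t Ax t0.
have x0 : 0 <= x by have := A0 _ Ax; rewrite /= in_itv/= andbT.
have [td|td] := ltP `|t - x| d.
  rewrite (le_trans (ltW (Ad x Ax x0 t t0 td)))// lerDl.
  by rewrite mulr_ge0 ?sqr_ge0// divr_ge0 ?sqr_ge0// mulr_ge0// ltW.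
apply: (@le_trans _ _ (2 * M)).
  rewrite (le_trans (ler_normB _ _))//.
  by have := fM _ t0; have := fM _ x0; lra.
rewrite (@le_trans _ _ (2 * M / d ^+ 2 * (t - x) ^+ 2))//; last by rewrite lerDr ltW.
rewrite mulrAC ler_pdivlMr ?exprn_gt0// ler_wpM2l//; first by rewrite mulr_ge0// ltW.
by rewrite -(real_normK (num_real (t - x))) lerXn2r// nnegrE ltW.
Unshelve. all: by end_near. Qed.

Theorem theorem2 (R : realType) (f : R -> R) (a0 a1 : nat -> R) :
  CB f ->
  cvg (a0 n @[n --> \oo]) ->
  cvg (a1 n @[n --> \oo]) ->
  (forall n : nat, (1 <= n)%N -> 2 * a0 n - a1 n = 1) ->
  ~ V1_positive a0 a1 ->
  forall A : set R, compact A -> A `<=` `[0, +oo[ ->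
    {uniform A, V1 a0 a1 n f @[n --> \oo] --> f}.
Proof.
move=> fCB ca0 ca1 a01 _ A cA A0.
have [M0 M0_gt0 a0M] : exists2 M, 0 < M & forall n, `|a0 n| <= M.
  have /pinfty_ex_gt0[M M_gt0 HM] := cvg_seq_bounded ca0.
  by exists M => // n; exact: HM.
have [M1 M1_gt0 a1M] : exists2 M, 0 < M & forall n, `|a1 n| <= M.
  have /pinfty_ex_gt0[M M_gt0 HM] := cvg_seq_bounded ca1.
  by exists M => // n; exact: HM.
have [r r0 Ar] : exists2 r, 0 < r & forall x, A x -> `|x| <= r.
  have /pinfty_ex_gt0[r r_gt0 Hr] := compact_bounded cA.
  by exists r => // x; exact: Hr.
move=> P /uniform_nbhs[E [entE EP]].
move: entE; rewrite -entourage_ballE => -[e /= e0 eE].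
(* K bounds |a(x,n)| + |b(x,n)| for x in A and all n. *)
pose K : R := 2 * M0 + M1 * (1 + 2 * r).
have K0 : 0 < K by rewrite /K; nra.
have [C C0 fC] := CB_quadratic_modulus R f A (e / (2 * K)) fCB cA A0
  (divr_gt0 e0 (mulr_gt0 (ltr0n R 2) K0)).
pose Q : R := C * (13 * (1 + r + r ^+ 2)).
have Q0 : 0 <= Q.
  by rewrite /Q !mulr_ge0// !addr_ge0// ?sqr_ge0// ltW.
have [n0 _ Hn0] : \forall N \near \oo, K * (Q / N.+1%:R) < e / 2.
  have KQ : 0 < K * Q + 1 by rewrite ltr_wpDl// mulr_ge0// ltW.
  have h0 : 0 < e / 2 / (K * Q + 1) by rewrite !divr_gt0.
  have := near_infty_natSinv_lt (PosNum h0); apply: filterS => N /=.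
  rewrite ltr_pdivlMr// => /(le_lt_trans _); apply.
  by rewrite mulrA [leRHS]mulrC ler_wpM2r ?invr_ge0// lerDl.
exists n0.+4 => // n /= n0n.
have n4 : (4 <= n)%N by exact: leq_trans n0n.
have nE : (n - 4).+4 = n by rewrite -addn4 subnK.
rewrite -nE; apply: EP => x Ax; apply: eE => /=.
rewrite /ball/= distrC.
have x0 : 0 <= x by have := A0 _ Ax; rewrite /= in_itv/= andbT.
have xr : x <= r by have := Ar _ Ax; rewrite ger0_norm.
apply: le_lt_trans.
  apply: (V1_dev R a0 a1 (n - 4) f (e / (2 * K)) C x) => //; last exact: a01.
  by move=> t; exact: fC.
have abK : `|acoef a0 a1 x (n - 4).+4| + `|bcoef a0 a1 x (n - 4).+4| <= K.
  have M1x : `|a1 (n - 4).+4| * x <= M1 * r by rewrite ler_pM.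
  have a0n := a0M (n - 4).+4; have a1n := a1M (n - 4).+4.
  rewrite /acoef /bcoef (le_trans (lerD (ler_normD _ _) (ler_normB _ _)))//.
  rewrite !normrM (ger0_norm x0) (ger0_norm (addr_ge0 ler01 x0)) /K.
  by lra.
have QN : C * (13 * (1 + x + x ^+ 2) / (n - 4).+1%:R) <= Q / (n - 4).+1%:R.
  rewrite mulrA ler_wpM2r ?invr_ge0// /Q ler_wpM2l// ler_wpM2l// lerD ?lerD2l//.
  by rewrite lerXn2r// nnegrE ltW.
apply: (@le_lt_trans _ _ (K * (e / (2 * K) + Q / (n - 4).+1%:R))).
  rewrite ler_pM ?addr_ge0// ?lerD2l//.
  - by rewrite divr_ge0 ?mulr_ge0// ltW.
  - by rewrite mulr_ge0// divr_ge0// mulr_ge0// !addr_ge0// sqr_ge0.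
rewrite mulrDr [ltRHS]splitr ler_ltD//.
  by rewrite invfM [e * _]mulrA mulrCA mulfV ?gt_eqF// mulr1.
by apply: Hn0; rewrite /= leq_subRL// addnC addn4.
Qed.
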